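(* Let $m$ and $e$ be integers with $2\le e\le m$. If $S\in\mathcal{C}(m,e)$, then $G([S])$ is a tree with root $S$. Moreover, if $P\in[S]$ and $\mathrm{msg}(P)=\{n_1<n_2<\cdots<n_e\}$, then the children of $P$ in $G([S])$ are the numerical semigroups of the form $\langle(\{n_1,\ldots,n_e\}\setminus\{n_k\})\cup\{n_k+n_1\}\rangle$ such that $k\in\{2,\ldots,e\}$, $n_k+n_1>n_e$ and $n_k+n_1\notin\langle\{n_1,\ldots,n_e\}\setminus\{n_k\}\rangle$.
   Context: $\mathbb{N}=\{0,1,2,\ldots\}$. A numerical semigroup is a subset $S\subseteq\mathbb{N}$ closed under addition, with $0\in S$ and $\mathbb{N}\setminus S$ finite. For $A\subseteq\mathbb{N}$ nonempty, $\langle A\rangle$ is the submonoid of $(\mathbb{N},+)$ generated by $A$. The multiplicity $m(S)$ is the least positive integer in $S$. Every numerical semigroup has a unique minimal (with respect to inclusion) system of generators, which is finite; it is denoted $\mathrm{msg}(S)$, and its cardinality $e(S)$ is the embedding dimension of $S$. $M(S)$ denotes the maximum of $\mathrm{msg}(S)$. $\mathcal{L}(m,e)$ is the set of all numerical semigroups with multiplicity $m$ and embedding dimension $e$. A numerical semigroup $S$ is packed if $\mathrm{msg}(S)\subseteq\{m(S),m(S)+1,\ldots,2m(S)-1\}$; $\mathcal{C}(m,e)$ is the set of packed numerical semigroups in $\mathcal{L}(m,e)$. For $S\in\mathcal{L}(m,e)$, $\phi(S)$ denotes the numerical semigroup generated by $\{m+(x\bmod m)\mid x\in\mathrm{msg}(S)\}$,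 where $x\bmod m\in\{0,\ldots,m-1\}$ is the remainder of $x$ upon division by $m$; and $[S]=\{T\in\mathcal{L}(m,e)\mid \phi(T)=\phi(S)\}$. A graph is a pair $(V,E)$ where $V$ is a set (the vertices) and $E\subseteq\{(v,w)\in V\times V\mid v\neq w\}$ (the edges). A path connecting $x$ and $y$ is a sequence of different edges $(v_0,v_1),(v_1,v_2),\ldots,(v_{n-1},v_n)$ with $v_0=x$ and $v_n=y$. A graph is a tree with root $r$ if $r$ is a vertex such that for any other vertex $x$ there exists a unique path connecting $x$ and $r$. If $(x,y)$ is an edge of a tree, $x$ is called a child of $y$. For $S\in\mathcal{C}(m,e)$, $G([S])$ is the graph whose vertex set is $[S]$ and in which $(A,B)\in[S]\times[S]$ is an edge if and only if $\mathrm{msg}(B)=(\mathrm{msg}(A)\setminus\{M(A)\})\cup\{M(A)-m\}$. *)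

(* Defs.v *)
From mathcomp Require Import all_boot all_order.
From mathcomp Require Import boolp classical_sets cardinality.

Set Implicit Arguments.
Unset Strict Implicit.
Unset Printing Implicit Defensive.

Local Open Scope classical_set_scope.

Definition submonoid (M : set nat) : Prop :=
  M 0 /\ forall x y, M x -> M y -> M (x + y).

Definition generated (A : set nat) : set nat := smallest submonoid A.

Definition numerical_semigroup (S : set nat) : Prop :=
  submonoid S /\ finite_set (~` S).

(* The least (resp. greatest) element of [A], with the junk value 0 when there
   is none. *)
Definition least (A : set nat) : nat :=
  xget 0 [set x | A x /\ forall y, A y -> x <= y].
Definition greatest (A : set nat) : nat :=
  xget 0 [set x | A x /\ forall y, A y -> y <= x].

Definition multiplicity (S : set nat) : nat := least [set x | S x /\ 0 < x].

Definition minimal_generators (S A : set nat) : Prop :=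
  generated A = S /\ forall B, B `<=` A -> generated B = S -> B = A.

(* Every numerical semigroup has exactly one minimal system of generators, so
   the choice made by [xget] is the only possible one; [set0] is a junk value
   for other sets. *)
Definition msg (S : set nat) : set nat := xget set0 (minimal_generators S).

Definition max_msg (S : set nat) : nat := greatest (msg S).

Definition semigroups (m e : nat) : set (set nat) :=
  [set S | [/\ numerical_semigroup S, multiplicity S = m & (msg S #= `I_e)%card]].

Definition packed (S : set nat) : Prop :=
  msg S `<=` [set x | multiplicity S <= x <= 2 * multiplicity S - 1].

Definition packed_semigroups (m e : nat) : set (set nat) :=
  semigroups m e `&` packed.

Definition phi (m : nat) (S : set nat) : set nat :=
  generated [set m + x %% m | x in msg S].

Definition phi_class (m e : nat) (S : set nat) : set (set nat) :=
  [set T | semigroups m e T /\ phi m T = phi m S].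

Record graph (T : Type) := Graph {
  vertices : set T;
  edges : set (T * T)
}.

Definition is_graph (T : Type) (G : graph T) : Prop :=
  forall v w, edges G (v, w) -> [/\ vertices G v, vertices G w & v <> w].

(* Edges are directed and a path is its sequence of edges: for
   [p = [:: v1; ...; vn]], [pairmap pair v0 p] is
   [:: (v0, v1); (v1, v2); ...; (v(n-1), vn)]. *)
Definition is_path (T : eqType) (G : graph T) (x y : T) (s : seq (T * T)) :
    Prop :=
  [/\ uniq s, [set` s] `<=` edges G
    & exists2 p : seq T, s = pairmap pair x p & last x p = y].

Definition is_tree (T : eqType) (G : graph T) (r : T) : Prop :=
  [/\ is_graph G, vertices G r
    & forall x, vertices G x -> x <> r -> exists! s, is_path G x r s].

Definition children (T : Type) (G : graph T) (y : T) : set T :=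
  [set x | edges G (x, y)].

Definition class_graph (m e : nat) (S : set nat) : graph (set nat) := {|
  vertices := phi_class m e S;
  edges := [set AB | [/\ phi_class m e S AB.1, phi_class m e S AB.2
    & msg AB.2 = (msg AB.1 `\ max_msg AB.1) `|` [set max_msg AB.1 - m]]]
|}.

(* Main.v *)
(* The minimal generators of a submonoid of N are its irreducible elements, that
   is, the nonzero elements that are not sums of two nonzero ones.  In the class
   graph every [A] has at most one parent, which strictly contains [A], so
   following parents removes gaps and must stop; it stops exactly when all
   minimal generators are below [2 * m], which forces [A = S]. *)
Require Import Defs.
From mathcomp Require Import all_boot all_order finmap zify.
From mathcomp Require Import boolp classical_sets cardinality.

Set Implicit Arguments.
Unset Strict Implicit.
Unset Printing Implicit Defensive.

Local Open Scope classical_set_scope.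

(** * Rooted trees from a functional parent relation *)

Lemma pairmap_edges_measure (T : eqType) (G : graph T) (mu : T -> nat) (x : T)
    (p : seq T) :
  (forall y z, edges G (y, z) -> mu z < mu y) ->
  [set` pairmap pair x p] `<=` edges G ->
  forall c, c \in pairmap pair x p -> mu c.1 <= mu x.
Proof.
move=> mu_lt; elim: p x => // y p IHp x sub_edges c /=.
rewrite inE => /predU1P[-> //|c_p].
have /mu_lt/ltnW : edges G (x, y) by apply: sub_edges; rewrite /= inE eqxx.
apply: leq_trans; apply: IHp c_p => d d_p.
by apply: sub_edges; rewrite /= inE; apply/orP; right.
Qed.

(** Strong induction on [mu] builds a path by following parents. It is unique because two paths out
    of [x] share each edge, and neither can stop first, as [r] has no outgoing edge. *)
Lemma is_tree_of_parent (T : eqType) (G : graph T) (r : T) (mu : T -> nat) :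
  is_graph G -> vertices G r ->
  (forall x y, edges G (x, y) -> mu y < mu x) ->
  (forall x y z, edges G (x, y) -> edges G (x, z) -> y = z) ->
  (forall y, ~ edges G (r, y)) ->
  (forall x, vertices G x -> x <> r -> exists y, edges G (x, y)) ->
  is_tree G r.
Proof.
move=> graphG Gr mu_lt edge_fun root_sink has_parent; split=> // x Gx _.
have [p [p_uniq p_edges p_last]] : exists p, [/\ uniq (pairmap pair x p),
    [set` pairmap pair x p] `<=` edges G & last x p = r].
  have [n] := ubnP (mu x); elim: n x Gx => // n IHn x Gx mu_x.
  have [->|/eqP x_r] := eqVneq x r; first by exists [::].
  have [y xy] := has_parent x Gx x_r.
  have mu_y := mu_lt _ _ xy.
  have [_ Gy _] := graphG _ _ xy.
  have [p [p_uniq p_edges p_last]] := IHn y Gy (leq_trans mu_y mu_x).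
  exists (y :: p); split=> //=; last first.
    by move=> c; rewrite /= inE => /predU1P[-> //|/p_edges].
  (* The new edge starts at [x], while every edge of the tail starts at a vertex of measure at most
     [mu y < mu x]. *)
  rewrite p_uniq andbT; apply/negP.
  by move/(pairmap_edges_measure mu_lt p_edges); rewrite /= leqNgt mu_y.
exists (pairmap pair x p); split; first by split=> //; exists p.
move=> s [_ q_edges [q sE q_last]]; rewrite {s}sE in q_edges *.
congr (pairmap pair x _).
elim: p q x {Gx p_uniq} p_last q_last p_edges q_edges
    => [|y p IHp] [|z q] x //= p_last q_last p_edges q_edges.
- by case: (root_sink z); rewrite -p_last; apply: q_edges; rewrite /= mem_head.
- by case: (root_sink y); rewrite -q_last; apply: p_edges; rewrite /= mem_head.
have xy : edges G (x, y) by apply: p_edges; rewrite /= mem_head.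
have xz : edges G (x, z) by apply: q_edges; rewrite /= mem_head.
move: q_last q_edges; rewrite -(edge_fun _ _ _ xy xz) => q_last q_edges.
congr (_ :: _); apply: (IHp q y) => // c c_p.
- by apply: p_edges; rewrite /= inE; apply/orP; right.
- by apply: q_edges; rewrite /= inE; apply/orP; right.
Qed.

(** * Extrema of sets of natural numbers *)

Lemma least_mem (A : set nat) x :
  A x -> A (least A) /\ forall y, A y -> least A <= y.
Proof.
move=> Ax; apply: (@xgetPex _ _ [set x | A x /\ forall y, A y -> x <= y]).
have ex : exists y, `[< A y >] by exists x; apply/asboolP.
case: (ex_minnP ex) => y /asboolP Ay y_min; exists y; split=> // z Az.
by apply: y_min; apply/asboolP.
Qed.

Lemma finite_set_nat_ub (A : set nat) :
  finite_set A -> exists N, forall x, A x -> x <= N.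
Proof.
move=> /finite_seqP[s ->]; exists (\max_(i <- s) i) => x /= x_s.
exact: (@leq_bigmax_seq _ s xpredT id).
Qed.

Lemma greatest_mem (A : set nat) x : finite_set A ->
  A x -> A (greatest A) /\ forall y, A y -> y <= greatest A.
Proof.
move=> /finite_set_nat_ub[N A_N] Ax.
apply: (@xgetPex _ _ [set x | A x /\ forall y, A y -> y <= x]).
have ex : exists y, `[< A y >] by exists x; apply/asboolP.
have ub y : `[< A y >] -> y <= N by move=> /asboolP/A_N.
case: (ex_maxnP ex ub) => y /asboolP Ay y_max; exists y; split=> // z Az.
by apply: y_max; apply/asboolP.
Qed.

Lemma greatest_eq (A : set nat) x :
  A x -> (forall y, A y -> y <= x) -> greatest A = x.
Proof.
move=> Ax A_x; apply: xget_unique => // y [Ay A_y].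
by apply/eqP; rewrite eqn_leq A_x // A_y.
Qed.

Lemma least_eq (A : set nat) x :
  A x -> (forall y, A y -> x <= y) -> least A = x.
Proof.
move=> Ax A_x; apply: xget_unique => // y [Ay A_y].
by apply/eqP; rewrite eqn_leq A_x // A_y.
Qed.

(** * Generated submonoids and irreducible elements *)

Lemma generated_submonoid (A : set nat) : submonoid (generated A).
Proof.
split=> [M [[]] //|x y Ax Ay M MA]; have [[_ MD] _] := MA.
by apply: MD; [exact: Ax | exact: Ay].
Qed.

Lemma generated_sub (A M : set nat) :
  submonoid M -> A `<=` M -> generated A `<=` M.
Proof. exact: smallest_sub. Qed.

Lemma sub_generated (A : set nat) : A `<=` generated A.
Proof. exact: sub_gen_smallest. Qed.

Lemma submonoid_mul (M : set nat) x k : submonoid M -> M x -> M (k * x).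
Proof. by move=> [M0 MD] Mx; elim: k => // k; rewrite mulSn; apply: MD. Qed.

(** A sum that uses [b] is at least [b]: the elements that lie in [generated A] or are at least [b]
    form a submonoid. *)
Lemma generated_setU1_lt (A : set nat) b x :
  generated (A `|` [set b]) x -> x < b -> generated A x.
Proof.
move=> Ax x_b; suff [//|] : generated A x \/ b <= x by rewrite leqNgt x_b.
have [A0 AD] := generated_submonoid A.
apply: (Ax [set y | generated A y \/ b <= y]); split; first split=> /=.
- by left.
- move=> y z [Ay|b_y] [Az|b_z]; [left; exact: AD|right; lia..].
- by move=> y [Ay|->]; [left; exact: sub_generated|right].
Qed.

Definition irreducibles (S : set nat) : set nat :=
  [set x | [/\ S x, x <> 0
    & forall a b, S a -> S b -> a + b = x -> a = 0 \/ b = 0]].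

Lemma irreducibles_sub (S T : set nat) x :
  S `<=` T -> S x -> irreducibles T x -> irreducibles S x.
Proof.
by move=> ST Sx [_ x0 x_irr]; split=> // a b /ST Ta /ST; apply: x_irr.
Qed.

Lemma generated_irreducibles (S : set nat) :
  submonoid S -> generated (irreducibles S) = S.
Proof.
move=> S_sub; apply/seteqP; split=> [|x].
  by apply: generated_sub => // x [].
have [I0 ID] := generated_submonoid (irreducibles S).
have [n] := ubnP x; elim: n x => // n IHn x x_n Sx.
have [-> //|/eqP x0] := eqVneq x 0.
have [/sub_generated //|] := pselect (irreducibles S x).
(* If [x] is not generated, it cannot split into two nonzero, hence smaller, elements, as these are
   generated by induction; so [x] is irreducible after all. *)
move=> x_red; apply: contrapT => Ix; apply: x_red; split=> // a b Sa Sb ab.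
have [->|a0] := eqVneq a 0; [by left|right].
apply: contrapT => b0; apply: Ix; rewrite -ab.
by apply: ID; apply: IHn => //; lia.
Qed.

(* Removing an irreducible element from a submonoid leaves a submonoid. *)
Lemma irreducibles_sub_generators (S A : set nat) :
  generated A = S -> irreducibles S `<=` A.
Proof.
move=> <- x [Sx x0 x_irr]; apply: contrapT => Ax.
have [A0 AD] := generated_submonoid A.
suff A_x : generated A `<=` generated A `\ x by have [_ /(_ erefl)] := A_x x Sx.
apply: generated_sub; last first.
  by move=> y Ay; split; [exact: sub_generated | move=> yx; rewrite -yx in Ax].
split=> [|a b [Aa ax] [Ab bx]]; first by split=> // /esym.
split; first exact: AD.
move=> /= ab; have [a0|b0] := x_irr a b Aa Ab ab.
- by apply: bx; rewrite -ab a0.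
- by apply: ax; rewrite -ab b0 addn0.
Qed.

(** The irreducibles generate [S] and lie in every generating set, so the choice behind [msg]
    becomes an explicit set. *)
Lemma msgE (S : set nat) : submonoid S -> msg S = irreducibles S.
Proof.
move=> S_sub; apply: xget_unique.
  split=> [|B B_irr genB]; first exact: generated_irreducibles.
  by apply/seteqP; split=> //; exact: irreducibles_sub_generators.
move=> A [genA A_min]; apply/esym/A_min; last exact: generated_irreducibles.
exact: irreducibles_sub_generators.
Qed.

Lemma generated_msg (S : set nat) : submonoid S -> generated (msg S) = S.
Proof. by move=> S_sub; rewrite msgE // generated_irreducibles. Qed.

Lemma msg_generated (A : set nat) :
  A `<=` irreducibles (generated A) -> msg (generated A) = A.
Proof.
move=> A_irr; rewrite msgE; last exact: generated_submonoid.
by apply/seteqP; split=> //; exact: irreducibles_sub_generators.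
Qed.

(** * Numerical semigroups, multiplicity and largest generator *)

Lemma cofinite_of_residues (M : set nat) m :
  submonoid M -> 0 < m -> M m ->
  (forall r, r < m -> exists2 x, M x & x %% m = r) -> finite_set (~` M).
Proof.
move=> M_sub m0 Mm res.
have [N resN] : exists N, forall r, r < m ->
    exists2 x, M x & x %% m = r /\ x <= N.
  (* Induction on the number of residues gives one bound for all representatives. *)
  have : forall k, k <= m -> exists N, forall r, r < k ->
      exists2 x, M x & x %% m = r /\ x <= N.
    elim=> [|k IHk] k_m; first by exists 0.
    have [N resN] := IHk (ltnW k_m).
    have [y My yk] := res k k_m.
    exists (N + y) => r; rewrite ltnS leq_eqVlt => /predU1P[->|/resN].
      by exists y => //; split=> //; lia.
    by case=> x Mx [xr xN]; exists x => //; split=> //; lia.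
  by move=> /(_ m (leqnn m)).
apply: (@sub_finite_set _ _ `I_N); last exact: finite_II.
move=> x /= Mx; rewrite ltnNge; apply/negP => N_x; apply: Mx.
have [y My [yx y_N]] := resN (x %% m) (ltn_pmod x m0).
have [_ MD] := M_sub.
(* [x] lies above the representative [y] of its class, so it is [y] plus a multiple of [m]. *)
have -> : x = y + (x %/ m - y %/ m) * m.
  have := leq_div2r m (leq_trans y_N N_x).
  by move: (divn_eq x m) (divn_eq y m); rewrite yx mulnBl; nia.
by apply: MD => //; exact: submonoid_mul.
Qed.

Lemma residue_mem (S : set nat) m r : numerical_semigroup S -> r < m ->
  exists2 x, S x & x %% m = r.
Proof.
move=> [_ /finite_set_nat_ub[N S_N]] rm; exists (N.+1 * m + r).
  by apply: contrapT => /S_N; nia.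
by rewrite modnMDl modn_small.
Qed.

Lemma semigroups_multiplicity m e (S : set nat) : semigroups m e S ->
  [/\ S m, 0 < m & forall x, S x -> 0 < x -> m <= x].
Proof.
move=> [S_num <- _]; have [_ /finite_set_nat_ub[N S_N]] := S_num.
(* Beyond the bound on the gaps lies a positive element, so [least] does not take its default
   value. *)
have SN : [set x | S x /\ 0 < x] N.+1.
  by split=> //; apply: contrapT => /S_N; rewrite ltnn.
have [[Sm m0] m_min] := least_mem SN.
by split=> // x Sx x0; apply: m_min.
Qed.

Lemma semigroups_msg m e (S : set nat) :
  semigroups m e S -> msg S = irreducibles S.
Proof. by move=> [[S_sub _] _ _]; exact: msgE. Qed.

(** A sum of two nonzero elements is at least [2 * m], hence exceeds [m]. *)
Lemma multiplicity_msg m e (S : set nat) : semigroups m e S -> msg S m.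
Proof.
move=> S_me; have [Sm m0 m_min] := semigroups_multiplicity S_me.
rewrite (semigroups_msg S_me); split=> // [|a b Sa Sb ab]; first lia.
by move: (m_min a Sa) (m_min b Sb); lia.
Qed.

Lemma multiplicity_le_msg m e (S : set nat) x :
  semigroups m e S -> msg S x -> m <= x.
Proof.
move=> S_me; have [_ _ m_min] := semigroups_multiplicity S_me.
by rewrite (semigroups_msg S_me) => -[Sx x0 _]; apply: m_min => //; lia.
Qed.

(** Otherwise [x = (x - m) + m] would be a sum of two nonzero elements. *)
Lemma msg_subnm m e (S : set nat) x :
  semigroups m e S -> msg S x -> x <> m -> m < x /\ ~ S (x - m).
Proof.
move=> S_me Sx xm; have mx := multiplicity_le_msg S_me Sx.
have [Sm m0 _] := semigroups_multiplicity S_me.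
split=> [|Sxm]; first lia.
move: Sx; rewrite (semigroups_msg S_me) => -[_ _ x_irr].
by case: (x_irr (x - m) m Sxm Sm); lia.
Qed.

Lemma max_msg_mem m e (S : set nat) : semigroups m e S ->
  msg S (max_msg S) /\ forall x, msg S x -> x <= max_msg S.
Proof.
move=> S_me; have [_ _ card_e] := S_me.
apply: (greatest_mem _ (multiplicity_msg S_me)).
by apply/finite_setP; exists e.
Qed.

(** If the largest generator were [m], which is also the smallest, there would be only one
    generator, against [2 <= e]. *)
Lemma max_msg_neq m e (S : set nat) :
  2 <= e -> semigroups m e S -> max_msg S <> m.
Proof.
move=> e2 S_me max_m; have [_ max_le] := max_msg_mem S_me.
have [_ _ card_e] := S_me.
have : msg S = [set m].
  apply/seteqP; split=> [x Sx /=|_ ->]; last exact: multiplicity_msg S_me.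
  apply/eqP; rewrite eqn_leq (multiplicity_le_msg S_me Sx) andbT -max_m.
  exact: max_le.
move=> msg_m; move: card_e; rewrite msg_m => card_e.
have : (`I_1 #= `I_e)%card.
  by apply: card_eq_trans card_e; rewrite card_eq_sym; exact: card_set1.
by move/card_eq_II; lia.
Qed.

(** * Moving a generator within its residue class *)

(** Phrasing the exchange of [a] for [b] as a map transports the cardinality and the residues of the
    generators. *)
Definition replace (a b x : nat) := if x == a then b else x.

Lemma image_replace (A : set nat) a b :
  A a -> replace a b @` A = (A `\ a) `|` [set b].
Proof.
move=> Aa; apply/seteqP; split=> [_ [x Ax <-]|x] /=; rewrite /replace.
  by case: eqP => [_|xa]; [right | left].
case=> [[Ax xa]|->]; last by exists a => //; rewrite eqxx.
by exists x => //; case: eqP xa.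
Qed.

Lemma setD1U1_cancel (A : set nat) a b : A a -> ~ A b ->
  (((A `\ a) `|` [set b]) `\ b) `|` [set a] = A.
Proof.
move=> Aa Ab; apply/seteqP; split=> x /=.
  by case=> [[[[] |->]]|->].
move=> Ax; have [->|/eqP xa] := eqVneq x a; first by right.
by left; split; [left | move=> xb; rewrite -xb in Ab].
Qed.

(* A semigroup of multiplicity [m] is cofinite as soon as it meets every residue
   class modulo [m], and moving a generator inside its class preserves this. *)
Lemma semigroups_replace m e (S : set nat) a b
    (C := (msg S `\ a) `|` [set b]) :
  semigroups m e S -> msg S a -> a <> m -> ~ msg S b -> m <= b ->
  a = b %[mod m] -> C `<=` irreducibles (generated C) ->
  [/\ semigroups m e (generated C), msg (generated C) = C
    & phi m (generated C) = phi m S].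
Proof.
move=> S_me Sa am Sb m_b ab C_irr.
have msgC := msg_generated C_irr.
have C_sub := generated_submonoid C; have [C0 CD] := C_sub.
have [[S_sub S_cofin] S_mult S_card] := S_me.
have [_ m0 _] := semigroups_multiplicity S_me.
have C_m : generated C m.
  apply: sub_generated; left; split; first exact: multiplicity_msg S_me.
  by move=> /= ma; apply: am.
have C_ge x : C x -> m <= x by case=> [[/(multiplicity_le_msg S_me)]|->].
have CE : C = replace a b @` msg S by rewrite image_replace.
split=> //; last first.
  rewrite /phi msgC CE image_comp; congr generated; apply: eq_imagel => x _ /=.
  by rewrite /replace; case: eqP => // ->; rewrite ab.
split; last 1 first.
- rewrite msgC CE; apply: card_eq_trans S_card; apply: inj_card_eq.
  move=> x y; rewrite !inE /replace => Sx Sy.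
  by do 2?case: eqP => //; [move=> -> -> | move=> _ _ byE; case: Sb; rewrite byE
    | move=> _ _ xbE; case: Sb; rewrite -xbE].
- split=> //; apply: (cofinite_of_residues C_sub m0 C_m) => r rm.
  have [x Sx xr] := residue_mem (conj S_sub S_cofin) rm.
  suff [j Cj] : exists j, generated C (x + j * m).
    by exists (x + j * m) => //; rewrite addnC modnMDl.
  move: Sx; rewrite -{1}(generated_msg S_sub).
  (* The elements that a multiple of [m] moves into [generated C] form a submonoid containing
     [msg S], hence all of [S]. *)
  move=> /(_ [set x | exists j, generated C (x + j * m)]); apply; split.
    split=> [|y z [i Ci] [j Cj]]; first by exists 0.
    by exists (i + j); rewrite mulnDl addnACA; exact: CD.
  move=> y Sy; have [->|/eqP ya] := eqVneq y a; last first.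
    by exists 0; rewrite addn0; apply: sub_generated; left; split.
  have Cb : generated C b by apply: sub_generated; right.
  (* Either [a] is shifted up to [b], or [a] is already [b] plus a multiple of [m]. *)
  have [a_b|b_a] := leqP a b.
    exists ((b - a) %/ m); rewrite divnK ?subnKC //.
    by rewrite -eqn_mod_dvd // ab.
  exists 0; rewrite addn0 -(subnKC (ltnW b_a)); apply: CD => //.
  have /divnK <- : m %| a - b by rewrite -eqn_mod_dvd ?ab // ltnW.
  exact: submonoid_mul C_sub C_m.
- apply: least_eq => // x [Cx x0].
  suff [xz|//] : x = 0 \/ m <= x by rewrite xz in x0.
  (* Zero and the numbers from [m] on form a submonoid containing [C]. *)
  apply: (Cx [set x | x = 0 \/ m <= x]); split; first split=> /=.
  + by left.
  + by move=> y z; lia.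
  + by move=> y /C_ge m_y; right.
Qed.

(** The map [m + x %% m] fixes every [x] with [m <= x < 2 * m]. *)
Lemma phi_packed m e (T : set nat) :
  semigroups m e T -> msg T `<=` [set x | x < 2 * m] -> phi m T = T.
Proof.
move=> T_me T_2m; have [[T_sub _] _ _] := T_me.
rewrite -[RHS](generated_msg T_sub); congr generated.
rewrite -[RHS]image_id; apply: eq_imagel => x Tx.
have m_x := multiplicity_le_msg T_me Tx; have := T_2m x Tx => /= x_2m.
rewrite -{1}(subnK m_x) modnDr modn_small; lia.
Qed.

(** * Edges of the class graph and existence of parents *)

Section ClassGraph.
Variables (m e : nat) (S : set nat).
Hypotheses (he : 2 <= e) (hS : packed_semigroups m e S).

Let edge A B := edges (class_graph m e S) (A, B).
Let S_me : semigroups m e S. Proof. by case: hS. Qed.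

(** Both [A] and [S] are then fixed by [phi m], which takes equal values on them. *)
Let packed_max A : phi_class m e S A -> max_msg A < 2 * m -> A = S.
Proof.
move=> [A_me phiA] max_2m; rewrite -(@phi_packed m e A) //; last first.
  have [_ max_le] := max_msg_mem A_me.
  by move=> x /max_le/leq_ltn_trans; apply.
rewrite phiA; apply: phi_packed S_me _ => x Sx /=.
have [_ /(_ x Sx)/=] := hS; have [_ -> _] := S_me.
have [_ m0 _] := semigroups_multiplicity S_me; lia.
Qed.

Let edge_max A B : edge A B -> [/\ m < max_msg A, ~ A (max_msg A - m),
  msg B (max_msg A - m) & ~ msg A (max_msg A - m)].
Proof.
move=> [/= [A_me _] _ msgB].
have [A_max _] := max_msg_mem A_me.
have [m_max A_maxm] := msg_subnm A_me A_max (max_msg_neq he A_me).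
split=> //; first by rewrite msgB; right.
by rewrite (semigroups_msg A_me) => -[].
Qed.

(** The only generator of [A] that is lost, [max_msg A], is the sum of the generators
    [max_msg A - m] and [m] of [B]. *)
Let edge_sub A B : edge A B -> A `<=` B.
Proof.
move=> AB; have [m_max _ B_maxm _] := edge_max AB.
case: AB => /= -[A_me _] [B_me _] msgB.
have [[A_sub _] _ _] := A_me; have [[B_sub _] _ _] := B_me.
have msgB_sub : msg B `<=` B by rewrite (semigroups_msg B_me) => x [].
rewrite -[A](generated_msg A_sub); apply: generated_sub => // x Ax.
have [->|/eqP x_max] := eqVneq x (max_msg A); last first.
  by apply: msgB_sub; rewrite msgB; left.
rewrite -(subnK (ltnW m_max)); have [_ BD] := B_sub.
by apply: BD; apply: msgB_sub => //; exact: multiplicity_msg B_me.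
Qed.

(** The gap [max_msg A - m] of [A] is filled in [B], and no new gap appears. *)
Let edge_gaps A B :
  edge A B -> #|` fset_set (~` B)| < #|` fset_set (~` A)|.
Proof.
move=> AB; have [_ A_maxm B_maxm _] := edge_max AB; have A_B := edge_sub AB.
case: AB => /= -[A_me _] [B_me _] _.
have [[_ A_fin] _ _] := A_me; have [[B_sub B_fin] _ _] := B_me.
apply: fproper_ltn_card; rewrite fproperEneq; apply/andP; split; last first.
  by rewrite -fset_set_sub // => x /= Bx /A_B.
apply/eqP => /(congr1 (fun X : {fset nat} => max_msg A - m \in X)).
rewrite !in_fset_set // => AB_max.
have : max_msg A - m \in ~` A by rewrite inE.
rewrite -AB_max inE; apply.
by move: B_maxm; rewrite (semigroups_msg B_me) => -[].
Qed.

Let edge_fun A B C : edge A B -> edge A C -> B = C.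
Proof.
move=> [/= _ [B_me _] msgB] [/= _ [C_me _] msgC].
have [[B_sub _] _ _] := B_me; have [[C_sub _] _ _] := C_me.
by rewrite -(generated_msg B_sub) -(generated_msg C_sub) msgB msgC.
Qed.

(** Since [max_msg S < 2 * m], the new generator would be smaller than [m]. *)
Let packed_no_edge A : ~ edge S A.
Proof.
move=> SA; have [m_max _ A_maxm _] := edge_max SA.
case: SA => /= _ [A_me _] _; have := multiplicity_le_msg A_me A_maxm.
have [S_max _] := max_msg_mem S_me.
have [_ /(_ _ S_max)/=] := hS; have [_ -> _] := S_me; lia.
Qed.

(* The elements of the new semigroup below [max_msg A - m] already belong to
   [A], so decomposing a new generator would decompose a generator of [A]. *)
Let has_parent A : phi_class m e S A -> A <> S -> exists B, edge A B.
Proof.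
move=> [A_me phiA] AS; have [[A_sub _] _ _] := A_me; have [A0 AD] := A_sub.
have [Am m0 m_min] := semigroups_multiplicity A_me.
have [A_max max_le] := max_msg_mem A_me; have max_m := max_msg_neq he A_me.
have [m_max A_maxm] := msg_subnm A_me A_max max_m.
(* A class member with all generators below [2 * m] equals [S]. The bound keeps [max_msg A - m] at
   or above [m]. *)
have max_2m : 2 * m <= max_msg A.
  by rewrite leqNgt; apply/negP => max_2m; exact: AS (packed_max _ _).
have [_ max0 max_irr] : irreducibles A (max_msg A).
  by rewrite -(semigroups_msg A_me).
set M := max_msg A in A_max max_le max_m m_max A_maxm max_2m max0 max_irr.
pose C := (msg A `\ M) `|` [set M - m].
have C_lt x : generated C x -> x < M - m -> A x.
  move=> Cx /(generated_setU1_lt Cx); apply: generated_sub => // y [].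
  by rewrite (semigroups_msg A_me) => -[].
have C_ge x : generated C x -> x <> 0 -> m <= x.
  move=> Cx x0; suff [//|//] : x = 0 \/ m <= x.
  apply: (Cx [set y | y = 0 \/ m <= y]); split; first split=> /=.
  - by left.
  - by move=> y z; lia.
  - move=> y [[/(multiplicity_le_msg A_me) m_y _]|->]; right => //; lia.
have C_irr : C `<=` irreducibles (generated C).
  move=> x Cx; have Gx := sub_generated Cx.
  case: Cx => [[Ax xM]|->].
  - move: (Ax); rewrite {1}(semigroups_msg A_me) => -[_ x0 x_irr].
    split=> // a b Ca Cb ab; have x_M := max_le x Ax.
    have [->|/eqP a0] := eqVneq a 0; first by left.
    have [->|/eqP b0] := eqVneq b 0; first by right.
    have a_m := C_ge a Ca a0; have b_m := C_ge b Cb b0.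
    (* As [x < M] and each summand is at least [m], both summands are below [M - m]. *)
    have /= xM' : x <> M by [].
    by apply: x_irr => //; apply: C_lt => //; lia.
  - split=> //; [exact: sub_generated (or_intror erefl) | lia |].
    move=> a b Ca Cb ab.
    have [->|/eqP a0] := eqVneq a 0; first by left.
    have [->|/eqP b0] := eqVneq b 0; first by right.
    have a_m := C_ge a Ca a0; have b_m := C_ge b Cb b0.
    have Aa : A a by apply: C_lt => //; lia.
    have Ab : A b by apply: C_lt => //; lia.
    (* A splitting of [M - m] would take place inside [A], which does not contain [M - m]. *)
    case: A_maxm; rewrite -ab; exact: AD.
have AM : ~ msg A (M - m) by rewrite (semigroups_msg A_me) => -[].
have m_M : m <= M - m by lia.
have modM : M = M - m %[mod m] by rewrite -{1}(subnK (ltnW m_max)) modnDr.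
have [B_me msgB phiB] :=
  semigroups_replace A_me A_max max_m AM m_M modM C_irr.
exists (generated C); split=> //=; first by split=> //; rewrite phiB.
Qed.

Lemma class_graph_tree : is_tree (class_graph m e S) S.
Proof.
(* The measure is the number of gaps. Only the absence of loops is left to prove. *)
apply: (@is_tree_of_parent _ _ _ (fun A => #|` fset_set (~` A)|)) => //.
move=> A B AB; have [A_S B_S _] := AB; split=> // A_B.
have [_ _ B_max A_max] := edge_max AB.
by apply: A_max; rewrite {1}A_B.
Qed.

(** * Children of a vertex *)

(** A child of [P] undoes the exchange, so its largest generator is some [n k + m]. The conditions
    on [k] express that this number is the maximum of the new generators and irreducible. *)
Lemma class_graph_children (P : set nat) (n : nat -> nat) :
  phi_class m e S P ->
  (forall i j, 1 <= i -> i < j -> j <= e -> n i < n j) ->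
  msg P = [set n i | i in [set i | 1 <= i <= e]] ->
  children (class_graph m e S) P =
    [set generated ((msg P `\ n k) `|` [set n k + n 1]) | k in
       [set k | [/\ 2 <= k <= e, n e < n k + n 1
                  & ~ generated (msg P `\ n k) (n k + n 1)]]].
Proof.
move=> P_class n_inc msgP; have [P_me phiP] := P_class.
have [[P_sub _] _ _] := P_me; have [_ PD] := P_sub.
have [Pm m0 _] := semigroups_multiplicity P_me.
have n_le i j : 1 <= i -> i <= j -> j <= e -> n i <= n j.
  by move=> i1; rewrite leq_eqVlt => /predU1P[-> //|ij] je; exact/ltnW/n_inc.
have Pn i : 1 <= i <= e -> msg P (n i) by move=> ie; rewrite msgP; exists i.
have n1 : n 1 = m.
  apply/eqP; rewrite eqn_leq; apply/andP; split; last first.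
    by apply: multiplicity_le_msg P_me _; apply: Pn; lia.
  have := multiplicity_msg P_me; rewrite {1}msgP => -[i /= /andP[i1 ie] <-].
  exact: n_le.
have le_ne x : msg P x -> x <= n e.
  by rewrite msgP => -[i /= /andP[i1 ie] <-]; exact: n_le.
rewrite n1; apply/seteqP; split=> [A AP|_ [k [k_e ne_k k_gen] <-]] /=.
- have [m_max A_maxm P_maxm msgA_maxm] := edge_max AP.
  have [/= [A_me phiA] _ msgPE] := AP.
  have [A_max max_le] := max_msg_mem A_me.
  have [[A_sub _] _ _] := A_me.
  move: (P_maxm); rewrite {1}msgP => -[k /= k_e nk].
  have maxE : n k + m = max_msg A by rewrite nk subnK // ltnW.
  have msgAE : (msg P `\ n k) `|` [set n k + m] = msg A.
    by rewrite maxE msgPE nk setD1U1_cancel.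
  have msgPk : msg P `\ n k = msg A `\ max_msg A.
    rewrite msgPE nk; apply/seteqP; split=> [x [[//|]]|x Ax] //.
    by split; [left | move=> /= xk; case: Ax => Ax _; rewrite -xk in msgA_maxm].
  exists k; last by rewrite msgAE generated_msg.
  (* For [k = 1] the largest generator of [A] would be [m + m], which is reducible. *)
  have k1 : k != 1.
    apply/eqP => k1; have := A_max; rewrite (semigroups_msg A_me) => -[_ _].
    have [Am _ _] := semigroups_multiplicity A_me.
    by move=> /(_ m m Am Am); rewrite -maxE k1 n1 => /(_ erefl); lia.
  split; first lia.
  (* [n e] is either a generator of [A] other than the largest, or [max_msg A - m]. *)
  + rewrite maxE; have : msg P (n e) by apply: Pn; lia.
    rewrite msgPE => -[[Ae ne_max]|->]; last by rewrite /=; lia.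
    by rewrite ltn_neqAle max_le // andbT; apply/eqP.
  (* If the other generators generated [max_msg A], it would be irreducible in their span and so be
     one of them. *)
  + rewrite maxE msgPk => max_gen.
    have [] : (msg A `\ max_msg A) (max_msg A).
      apply: (irreducibles_sub_generators erefl).
      apply: (@irreducibles_sub _ A) => //; last first.
        by rewrite -(semigroups_msg A_me).
      apply: generated_sub => // x [].
      by rewrite (semigroups_msg A_me) => -[].
    by move=> _ /(_ erefl).
- have Pk : msg P (n k) by apply: Pn; lia.
  have k_m : n k <> m.
    by rewrite -n1; have := n_inc 1 k isT; move: k_e; case: ltnP => //; lia.
  have Pkm : ~ msg P (n k + m) by move/le_ne; rewrite leqNgt ne_k.
  have modk : n k = n k + m %[mod m] by rewrite modnDr.
  pose C := (msg P `\ n k) `|` [set n k + m].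
  have PG : msg P `<=` P by rewrite (semigroups_msg P_me) => x [].
  have C_P : generated C `<=` P.
    apply: generated_sub => // x [[/PG //]|->].
    by apply: PD => //; exact: PG.
  have C_irr : C `<=` irreducibles (generated C).
    move=> x Cx; have Gx := sub_generated Cx; case: Cx => [[Px _]|xk].
      (* Old generators stay irreducible because the new semigroup is contained in [P]. *)
      by apply: irreducibles_sub C_P Gx _; rewrite -(semigroups_msg P_me).
    split=> //; first by rewrite xk /=; lia.
    rewrite xk => a b Ca Cb ab.
    have [->|/eqP a0] := eqVneq a 0; first by left.
    have [->|/eqP b0] := eqVneq b 0; first by right.
    (* Both summands are below [n k + m], so they come from the other generators, against
       [k_gen]. *)
    have [_ GD] := generated_submonoid (msg P `\ n k).
    case: k_gen; rewrite -ab.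
    by apply: GD; [apply: (generated_setU1_lt Ca) |
      apply: (generated_setU1_lt Cb)]; lia.
  have [C_me msgC phiC] :=
    semigroups_replace P_me Pk k_m Pkm (leq_addl _ _) modk C_irr.
  (* By [ne_k] the new generator is the largest, so the step to the parent gives back [n k]. *)
  have C_max : max_msg (generated C) = n k + m.
    rewrite /max_msg msgC; apply: greatest_eq; first by right.
    by move=> x [[/le_ne x_ne _]|-> //]; apply: leq_trans x_ne (ltnW _).
  split=> //=; first by split=> //; rewrite phiC.
  by rewrite msgC C_max addnK setD1U1_cancel.
Qed.

End ClassGraph.

Theorem theorem9 (m e : nat) (S : set nat) (he : 2 <= e) (hem : e <= m)
    (hS : packed_semigroups m e S) :
  is_tree (class_graph m e S) S /\
  (forall (P : set nat) (n : nat -> nat),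
     phi_class m e S P ->
     (forall i j, 1 <= i -> i < j -> j <= e -> n i < n j) ->
     msg P = [set n i | i in [set i | 1 <= i <= e]] ->
     children (class_graph m e S) P =
       [set generated ((msg P `\ n k) `|` [set n k + n 1]) | k in
          [set k | [/\ 2 <= k <= e, n e < n k + n 1
                     & ~ generated (msg P `\ n k) (n k + n 1)]]]).
Proof.
split; first exact: class_graph_tree.
by move=> P n; exact: class_graph_children.
Qed.
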